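(* For every graph $G$, $$\alpha(G)\le\min_{(M,x)\in\mathcal{P}(G)}F(M,x)=\vartheta'(G),$$ with equality $\alpha(G)=\vartheta'(G)$ if and only if there exist $(M,x)\in\mathcal{P}(G)$ and an independent set $C$ of $G$ such that $M[C]$ is diagonal and, with $c=\max_{u\in V(G)}\frac{(M)_{uu}}{x_u^2}$, one has $\frac{(M)_{vv}}{x_v^2}=c$ for all $v\in C$ and $c\,x_v=\sum_{u\in C}(M)_{vu}x_u^{-1}$ for all $v\notin C$.
   Context: $\alpha(G)$ is the independence number of the $n$-vertex graph $G$. $M^\#$ is the group inverse (unique $X$ with $MXM=M$, $XMX=X$, $MX=XM$). $R(M)$ is the column space; $M[C]$ the principal submatrix indexed by $C$; a vector is total nonzero if all entries are nonzero. $\mathcal{P}(G)$ is the set of pairs $(M,x)$ with $M$ a real positive semidefinite matrix indexed by $V(G)$ and $x\in R(M)$ total nonzero such that $(M)_{ij}x_ix_j\le0$ for all distinct nonadjacent $i,j$. $F(M,x)=x^\top M^\#x\max_{u\in V(G)}\frac{(M)_{uu}}{x_u^2}$. The Schrijver theta function $\vartheta'(G)$ is the minimum of the largest eigenvalue over real symmetric matrices $A$ indexed by $V(G)$ with $(A)_{ij}\ge1$ whenever $i=j$ or $i,j$ are nonadjacent. *)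

(* Defs.v *)
From HB Require Import structures.
From mathcomp Require Import all_boot all_order all_algebra.
From mathcomp Require Import all_classical all_reals.

Set Implicit Arguments.
Unset Strict Implicit.
Unset Printing Implicit Defensive.

Import Order.TTheory GRing.Theory Num.Theory.
Local Open Scope classical_set_scope.
Local Open Scope ring_scope.

Record sgraph (n : nat) := SGraph {
  adj :> rel 'I_n;
  adj_sym : symmetric adj;
  adj_irrefl : irreflexive adj }.

Definition independent (n : nat) (G : sgraph n) (C : {set 'I_n}) : bool :=
  [forall i in C, forall j in C, ~~ G i j].

Definition alpha (n : nat) (G : sgraph n) : nat :=
  \max_(C : {set 'I_n} | independent G C) #|C|.

Definition is_minimum (R : realType) (S : set R) (m : R) : Prop :=
  S m /\ lbound S m.

Definition symmetric_mx (R : realType) (n : nat) (A : 'M[R]_n) : Prop :=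
  A^T = A.

Definition psd (R : realType) (n : nat) (M : 'M[R]_n) : Prop :=
  symmetric_mx M /\ forall y : 'cV[R]_n, 0 <= (y^T *m M *m y) 0 0.

Definition principal_submx (R : realType) (n : nat) (M : 'M[R]_n)
    (C : {set 'I_n}) : 'M[R]_#|C| :=
  mxsub (fun k : 'I_#|C| => enum_val k) (fun k : 'I_#|C| => enum_val k) M.

Definition column_space (R : realType) (n : nat) (M : 'M[R]_n) :
    set 'cV[R]_n :=
  [set x | exists y : 'cV[R]_n, x = M *m y].

Definition total_nonzero (R : realType) (n : nat) (x : 'cV[R]_n) : Prop :=
  forall i, x i 0 != 0.

Definition is_group_inverse (R : realType) (n : nat) (M X : 'M[R]_n) : Prop :=
  [/\ M *m X *m M = M, X *m M *m X = X & M *m X = X *m M].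

(* The value is 0 when M has no group inverse; a symmetric real matrix
   always has one. *)
Definition group_inverse (R : realType) (n : nat) (M : 'M[R]_n) : 'M[R]_n :=
  xget 0 (is_group_inverse M).

Lemma is_group_inverse_uniq (R : realType) (n : nat) (M X Y : 'M[R]_n) :
  is_group_inverse M X -> is_group_inverse M Y -> X = Y.
Proof.
move=> [MXM XMX MX] [MYM YMY MY].
have XY : M *m X = M *m Y.
  have -> : M *m X = (M *m Y) *m (M *m X) by rewrite mulmxA MYM.
  by rewrite MX {1}MY -mulmxA (mulmxA M X M) MXM -MY.
by rewrite -XMX -mulmxA XY mulmxA -MX XY MY YMY.
Qed.

Definition PG (R : realType) (n : nat) (G : sgraph n) :
    set ('M[R]_n * 'cV[R]_n) :=
  [set Mx | [/\ psd Mx.1, column_space Mx.1 Mx.2, total_nonzero Mx.2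
     & forall i j, i != j -> ~~ G i j ->
         Mx.1 i j * Mx.2 i 0 * Mx.2 j 0 <= 0]].
Arguments PG R {n} G.

(* The neutral element 0 plays no role when 0 < n and M is positive
   semidefinite, since the ratios are then nonnegative. *)
Definition max_ratio (R : realType) (n : nat) (M : 'M[R]_n) (x : 'cV[R]_n) :
    R :=
  \big[Num.max/0]_(u < n) (M u u / x u 0 ^+ 2).

Definition F (R : realType) (n : nat) (M : 'M[R]_n) (x : 'cV[R]_n) : R :=
  (x^T *m group_inverse M *m x) 0 0 * max_ratio M x.

Definition F_values (R : realType) (n : nat) (G : sgraph n) : set R :=
  [set F Mx.1 Mx.2 | Mx in PG R G].
Arguments F_values R {n} G.

Definition is_largest_eigenvalue (R : realType) (n : nat) (A : 'M[R]_n)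
    (l : R) : Prop :=
  eigenvalue A l /\ forall a : R, eigenvalue A a -> a <= l.

Definition schrijver_feasible (R : realType) (n : nat) (G : sgraph n)
    (A : 'M[R]_n) : Prop :=
  symmetric_mx A /\ forall i j, (i == j) || ~~ G i j -> 1 <= A i j.

Definition schrijver_values (R : realType) (n : nat) (G : sgraph n) : set R :=
  [set l | exists2 A : 'M[R]_n,
     schrijver_feasible G A & is_largest_eigenvalue A l].
Arguments schrijver_values R {n} G.

(* Written as an infimum to have a total function; that the infimum is
   attained has to be asserted separately. *)
Definition schrijver_theta (R : realType) (n : nat) (G : sgraph n) : R :=
  inf (schrijver_values R G).
Arguments schrijver_theta R {n} G.

(* Main.v *)
Require Import Defs.
From mathcomp Require Import all_boot all_order all_algebra.
From mathcomp Require Import all_classical all_reals.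
From mathcomp Require Import topology normedtype derive.
From mathcomp Require Import ring lra.

(* Replacing (M, x) by (D^-1 M D^-1, 1) with D = diag x, one may assume x = 1,
   and then F(N, 1) = s c with N z = 1, s = 1^T z and c the largest diagonal
   entry of N. By Cauchy-Schwarz s N - J is positive semidefinite, and adding
   the diagonal matrix with entries s (c - N_ii) gives s c I - A with A feasible
   for theta', so theta' <= F. Conversely, if A is optimal, then
   N = theta' I - A + J is admissible and F(N, 1) <= theta'.

   For C independent with indicator vector w, w^T (theta' I - A) w >= 0 gives
   |C| <= theta'. If |C| = theta' then (theta' I - A) w = 0 and A = J on C,
   which is the tightness condition for N. Conversely, the tightness condition
   reads N w = c 1, whence F = s c = z^T N w = |C|.

   The minimum in theta' is attained by compactness: the matrices L I - A of
   bounded L, with A feasible of unit diagonal, have bounded entries. *)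

Set Implicit Arguments.
Unset Strict Implicit.
Unset Printing Implicit Defensive.

Import Order.TTheory GRing.Theory Num.Theory.
Import numFieldNormedType.Exports.
Local Open Scope classical_set_scope.
Local Open Scope ring_scope.

(** * Bilinear forms and Cauchy-Schwarz for positive semidefinite matrices *)

Section BilinearForm.
Variables (R : realType) (n : nat).
Implicit Types (M A : 'M[R]_n) (u v y : 'cV[R]_n) (a b : R).

Definition bform M u v : R := (u^T *m M *m v) 0 0.

Lemma bformE M u v : bform M u v = \sum_i \sum_j u i 0 * M i j * v j 0.
Proof.
rewrite /bform mxE exchange_big /=; apply: eq_bigr => j _.
by rewrite mxE mulr_suml; apply: eq_bigr => i _; rewrite mxE.
Qed.

Lemma bformDl M u v y : bform M (u + v) y = bform M u y + bform M v y.
Proof. by rewrite /bform linearD !mulmxDl mxE. Qed.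

Lemma bformDr M u v y : bform M y (u + v) = bform M y u + bform M y v.
Proof. by rewrite /bform mulmxDr mxE. Qed.

Lemma bformZl M a u y : bform M (a *: u) y = a * bform M u y.
Proof. by rewrite /bform linearZ /= -!scalemxAl mxE. Qed.

Lemma bformZr M a u y : bform M y (a *: u) = a * bform M y u.
Proof. by rewrite /bform -scalemxAr mxE. Qed.

Lemma bformD M A u v : bform (M + A) u v = bform M u v + bform A u v.
Proof. by rewrite /bform mulmxDr mulmxDl mxE. Qed.

Lemma bformB M A u v : bform (M - A) u v = bform M u v - bform A u v.
Proof. by rewrite /bform mulmxBr mulmxBl !mxE. Qed.

Lemma bformZ a M u v : bform (a *: M) u v = a * bform M u v.
Proof. by rewrite /bform -scalemxAr -scalemxAl mxE. Qed.

Lemma bform_sym M u v : symmetric_mx M -> bform M u v = bform M v u.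
Proof.
move=> sM; rewrite /bform.
have -> : v^T *m M *m u = (u^T *m M *m v)^T.
  by rewrite !trmx_mul trmxK sM mulmxA.
by rewrite [RHS]mxE.
Qed.

Lemma bform_mulr M A u v : bform M u (A *m v) = bform (M *m A) u v.
Proof. by rewrite /bform !mulmxA. Qed.

Lemma bform_const u v : bform (const_mx 1) u v = (\sum_i u i 0) * \sum_i v i 0.
Proof.
rewrite bformE mulr_suml; apply: eq_bigr => i _; rewrite mulr_sumr.
by apply: eq_bigr => j _; rewrite mxE mulr1.
Qed.

Lemma bform_diag (d : 'rV[R]_n) u : bform (diag_mx d) u u = \sum_i d 0 i * u i 0 ^+ 2.
Proof.
rewrite bformE; apply: eq_bigr => i _; rewrite (bigD1 i) //= big1 ?addr0.
  by rewrite !mxE eqxx mulr1n; ring.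
by move=> j ji; rewrite !mxE eq_sym (negPf ji) mulr0n mulr0 mul0r.
Qed.

Lemma bform_scalar a u : bform a%:M u u = a * \sum_i u i 0 ^+ 2.
Proof.
rewrite -diag_const_mx bform_diag mulr_sumr.
by apply: eq_bigr => i _; rewrite mxE.
Qed.

Lemma bform_delta M i j :
  bform M (delta_mx i 0) (delta_mx j 0) = M i j.
Proof. by rewrite /bform trmx_delta -rowE -colE !mxE. Qed.

Lemma sum_sqr_eq0 u : (\sum_i u i 0 ^+ 2 == 0) = (u == 0).
Proof.
apply/idP/eqP => [|->]; last first.
  by rewrite big1 // => i _; rewrite mxE expr0n.
rewrite psumr_eq0 => [/allP u0|i _]; last exact: sqr_ge0.
apply/matrixP => i j; rewrite ord1 mxE; apply/eqP.
by rewrite -sqrf_eq0 (eqP (u0 i _)) // mem_index_enum.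
Qed.

Lemma sum_sqr_ge0 u : 0 <= \sum_i u i 0 ^+ 2.
Proof. by apply: sumr_ge0 => i _; apply: sqr_ge0. Qed.

Lemma bform_le M u :
  bform M u u <= (\sum_i \sum_j `|M i j|) * \sum_i u i 0 ^+ 2.
Proof.
rewrite bformE mulr_suml; apply: ler_sum => i _; rewrite mulr_suml.
apply: ler_sum => j _.
have le k : u k 0 ^+ 2 <= \sum_i u i 0 ^+ 2.
  by rewrite (bigD1 k) //= lerDl sumr_ge0 // => l _; apply: sqr_ge0.
have := le i; have := le j; set q := \sum_i _ => lej lei.
apply: le_trans (ler_norm _) _; rewrite !normrM.
rewrite [`|u i 0| * _]mulrC -mulrA; apply: ler_wpM2l; rewrite ?normr_ge0 //.
rewrite -ler_sqr ?nnegrE ?mulr_ge0 ?sum_sqr_ge0 //.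
rewrite exprMn !real_normK ?num_real // [leRHS]expr2.
by apply: ler_pM => //; apply: sqr_ge0.
Qed.

Lemma symmetric_mxP M : symmetric_mx M <-> forall i j, M i j = M j i.
Proof.
split=> [sM i j|sM]; first by rewrite -[in LHS]sM mxE.
by apply/matrixP => i j; rewrite mxE.
Qed.

Lemma psd_bform M : psd M <-> symmetric_mx M /\ forall y, 0 <= bform M y y.
Proof. by []. Qed.

Lemma psd_diag_ge0 M i : psd M -> 0 <= M i i.
Proof. by move=> [_ /(_ (delta_mx i 0))]; rewrite -/(bform _ _ _) bform_delta. Qed.

Lemma bform_cauchy_schwarz M u v :
  psd M -> bform M u v ^+ 2 <= bform M u u * bform M v v.
Proof.
move=> /psd_bform[sM pM].
have Q a b : 0 <= a ^+ 2 * bform M u u + 2 * a * b * bform M u v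
                  + b ^+ 2 * bform M v v.
  have := pM (a *: u + b *: v).
  rewrite !(bformDl, bformDr, bformZl, bformZr) (bform_sym v u sM).
  by congr (0 <= _); ring.
have := pM u; have := pM v; move: Q.
move: (bform M u u) (bform M u v) (bform M v v) => p q r Q r0 p0.
move: p0; rewrite le_eqVlt => /orP[/eqP p0|p0].
  (* For [p = 0] this value of the form is [- (r + 2) * q ^+ 2], which forces [q = 0]. *)
  have := Q (- (r + 1)) q; rewrite -p0.
  by have := sqr_ge0 q; nra.
have := Q (- q) p.
have -> : (- q) ^+ 2 * p + 2 * (- q) * p * q + p ^+ 2 * r = p * (p * r - q ^+ 2).
  by ring.
by rewrite pmulr_rge0 // subr_ge0.
Qed.

(** Cauchy-Schwarz for [M *m u] and [u]: their product under the form is the squared norm of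
    [M *m u], and the bound is 0. *)
Lemma psd_bform_eq0 M u : psd M -> bform M u u = 0 -> M *m u = 0.
Proof.
move=> pM u0; apply/eqP; rewrite -sum_sqr_eq0.
have := bform_cauchy_schwarz (M *m u) u pM; rewrite u0 mulr0.
have -> : bform M (M *m u) u = \sum_i (M *m u) i 0 ^+ 2.
  rewrite (bform_sym _ _ pM.1) bform_mulr -[RHS]mul1r -bform_scalar.
  by rewrite /bform trmx_mul (proj1 pM) mulmx1 !mulmxA.
by move=> h; rewrite -sqrf_eq0 eq_le h sqr_ge0.
Qed.

(** Cauchy-Schwarz on basis vectors gives [M i j ^+ 2 <= M i i * M j j]. This puts slack matrices
    with bounded diagonal in a compact box. *)
Lemma psd_entry_le M K i j : psd M -> (forall k, M k k <= K) -> `|M i j| <= K.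
Proof.
move=> pM dK; have K0 : 0 <= K := le_trans (psd_diag_ge0 i pM) (dK i).
rewrite -ler_sqr ?nnegrE ?normr_ge0 // real_normK ?num_real //.
have := bform_cauchy_schwarz (delta_mx i 0) (delta_mx j 0) pM.
rewrite !bform_delta => /le_trans; apply; rewrite expr2.
by apply: ler_pM; rewrite ?psd_diag_ge0.
Qed.

End BilinearForm.

(** * Group inverses of symmetric matrices *)

Section GroupInverse.
Variables (R : realType) (n : nat).
Implicit Types (M : 'M[R]_n) (u v x y : 'cV[R]_n).

(** If [M *m (M *m w) = 0], symmetry makes the norm of [M *m w] vanish. So [M] and [M *m M] have the
    same kernel, hence the same row space. *)
Lemma symmetric_sub_sqr M : symmetric_mx M -> exists D, D *m M *m M = M.
Proof.
move=> sM; suff /submxP[D MD] : (M <= M *m M)%MS by exists D; rewrite -mulmxA.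
rewrite submxE; apply/eqP/matrixP => i j; rewrite [RHS]mxE.
pose w := col j (cokermx (M *m M)).
have MMw : M *m (M *m w) = 0.
  by rewrite mulmxA /w colE mulmxA mulmx_coker mul0mx.
suff/matrixP/(_ i 0) : M *m w = 0.
  by rewrite /w colE mulmxA -colE [LHS]mxE => ->; rewrite mxE.
apply/eqP; rewrite -sum_sqr_eq0 -[X in X == _]mul1r -bform_scalar.
by rewrite /bform trmx_mul sM mulmx1 -mulmxA MMw mulmx0 mxE.
Qed.

(** Transposing [D *m M *m M = M] gives [M *m M *m D^T = M]. The inverse is then [D *m M *m D^T],
    whose products with [M] on either side are both [D *m M]. *)
Lemma group_inverseP M :
  symmetric_mx M -> is_group_inverse M (group_inverse M).
Proof.
move=> sM; apply: xgetPex; have [D DMM] := symmetric_sub_sqr sM.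
have MME : M *m M *m D^T = M.
  by rewrite -[RHS]sM -[in RHS]DMM !trmx_mul sM mulmxA.
have DM : D *m M = M *m D^T by rewrite -{1}MME 2!mulmxA DMM.
pose X := D *m M *m D^T.
have XE : X = D *m (D *m M) by rewrite /X -mulmxA -DM.
have XM : X *m M = D *m M by rewrite XE -mulmxA DMM.
have MX : M *m X = D *m M by rewrite /X {1}DM !mulmxA MME.
exists X; split; first by rewrite MX.
- by rewrite XM -mulmxA MX XE.
- by rewrite MX XM.
Qed.

(** For a vector in the range the group inverse disappears, because [M *m X *m M = M]. *)
Lemma F_rangeE M y : psd M ->
  F M (M *m y) = bform M y y * max_ratio M (M *m y).
Proof.
move=> pM; have [MXM _ _] := group_inverseP pM.1; congr (_ * _).
by rewrite /bform trmx_mul pM.1 -(mulmxA _ _ (M *m y)) !mulmxA -3!(mulmxA y^T) MXM mulmxA.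
Qed.

End GroupInverse.

(** * The largest eigenvalue of [A] as the least [l] with [l%:M - A] positive semidefinite *)

Section LargestEigenvalue.
Variables (R : realType) (n : nat).
Implicit Types (M A : 'M[R]_n) (u v x y : 'cV[R]_n) (a e l : R).

Lemma symmetric_scalar_sub A a : symmetric_mx A -> symmetric_mx (a%:M - A).
Proof. by move=> sA; rewrite /symmetric_mx linearB /= tr_scalar_mx sA. Qed.

(* With [u = M^-1 y], Cauchy-Schwarz for [M] gives
   [(y^T y)^2 <= (y^T M^-1 y) (y^T M y)], and the first factor is at most
   a constant times [y^T y]. *)
Lemma psd_unitmx_sub M : psd M -> M \in unitmx ->
  exists2 e, 0 < e & psd (M - e%:M).
Proof.
move=> pM uM; pose K := 1 + \sum_i \sum_j `|invmx M i j|.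
have K0 : 0 < K.
  by rewrite ltr_wpDr // sumr_ge0 // => i _; rewrite sumr_ge0.
exists K^-1; first by rewrite invr_gt0.
apply/psd_bform; split=> [|y].
  by rewrite /symmetric_mx linearB /= tr_scalar_mx pM.1.
rewrite bformB bform_scalar subr_ge0 mulrC ler_pdivrMr //.
have := bform_cauchy_schwarz (invmx M *m y) y pM.
have -> : bform M (invmx M *m y) (invmx M *m y) = bform (invmx M) y y.
  by rewrite bform_mulr mulmxV // /bform trmx_mul trmx_inv pM.1 mulmx1.
have -> : bform M (invmx M *m y) y = \sum_i y i 0 ^+ 2.
  by rewrite (bform_sym _ _ pM.1) bform_mulr mulmxV // bform_scalar mul1r.
have := bform_le (invmx M) y; have := sum_sqr_ge0 y.
have := pM.2 y; rewrite -/(bform M y y).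
move: (bform M y y) (\sum_i y i 0 ^+ 2) (bform (invmx M) y y) => p q r.
rewrite /K; set k := \sum_i _ => p0 q0 rk.
have k0 : 0 <= k by rewrite sumr_ge0 // => i _; rewrite sumr_ge0.
have [->|q1] := eqVneq q 0; first by rewrite mulr_ge0 ?addr_ge0.
have {q1}q0 : 0 < q by rewrite lt_neqAle eq_sym q1.
move=> qrp; rewrite -(ler_pM2l q0) -expr2; apply: le_trans qrp _.
have := ler_wpM2r p0 rk.
have := mulr_ge0 (ltW q0) p0; lra.
Qed.

Lemma eigenvalue_le_psd A l a :
  eigenvalue A l -> psd (a%:M - A) -> l <= a.
Proof.
move=> /eigenvalueP[v vA v0] /psd_bform[_ /(_ v^T)].
rewrite bformB bform_scalar /bform trmxK vA -scalemxAl mxE.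
have -> : (v *m v^T) 0 0 = \sum_i v^T i 0 ^+ 2.
  by rewrite -[RHS]mul1r -bform_scalar /bform mulmx1 trmxK.
rewrite -mulrBl pmulr_lge0 ?subr_ge0 //.
by rewrite lt_neqAle sum_sqr_ge0 eq_sym sum_sqr_eq0 trmx_eq0 v0.
Qed.

(** The infimum [l] of all such scalars is attained, since each vector only imposes a lower bound on
    them. If [l%:M - A] were invertible, [l] could be decreased by some [e > 0]; so it is
    singular. *)
Lemma largest_eigenvalue_exists A : (0 < n)%N -> symmetric_mx A ->
  exists2 l, is_largest_eigenvalue A l & psd (l%:M - A).
Proof.
move=> n0 sA; pose S := [set l | psd (l%:M - A)].
pose i0 := Ordinal n0.
have S0 : S !=set0.
  exists (\sum_i \sum_j `|A i j|); apply/psd_bform; split=> [|y].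
    exact: symmetric_scalar_sub.
  by rewrite bformB bform_scalar subr_ge0 bform_le.
have Slb : has_lbound S.
  exists (A i0 i0) => l /(psd_diag_ge0 i0).
  by rewrite !mxE eqxx mulr1n subr_ge0.
pose l := inf S.
have pl : psd (l%:M - A).
  apply/psd_bform; split=> [|y]; first exact: symmetric_scalar_sub.
  have [q0|q0] := eqVneq (\sum_i y i 0 ^+ 2) 0.
    move/eqP: q0; rewrite sum_sqr_eq0 => /eqP ->.
    by rewrite /bform mulmx0 mxE.
  have {}q0 : 0 < \sum_i y i 0 ^+ 2 by rewrite lt_neqAle eq_sym q0 sum_sqr_ge0.
  rewrite bformB bform_scalar subr_ge0 -ler_pdivrMr //.
  apply: lb_le_inf => // a /psd_bform[_ /(_ y)].
  by rewrite bformB bform_scalar subr_ge0 -ler_pdivrMr.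
exists l => //; split.
  rewrite /eigenvalue /eigenspace kermx_eq0 row_free_unit; apply/negP => uA.
  have ulA : l%:M - A \in unitmx by rewrite -opprB -scaleN1r unitmxZ ?unitrN1.
  have [e e0 pe] := psd_unitmx_sub pl ulA.
  suff : l <= l - e by move: e0; lra.
  apply: ge_inf => //; rewrite /S /= raddfB /=.
  by rewrite addrAC.
by move=> a /eigenvalue_le_psd; apply.
Qed.

Lemma largest_eigenvalue_psd A l : (0 < n)%N -> symmetric_mx A ->
  is_largest_eigenvalue A l -> psd (l%:M - A).
Proof.
move=> n0 sA [el ml]; have [l' [el' ml'] pl] := largest_eigenvalue_exists n0 sA.
by have -> : l = l' by apply/eqP; rewrite eq_le ml ?ml'.
Qed.

End LargestEigenvalue.

(** * Minimisation over a compact set cut out by continuous inequalities *)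

Lemma compact_constraints_min (R : realType) (I : eqType) (k : R)
  (C : set ((I -> R) -> R)) (g : (I -> R) -> R) :
  let T := prod_topology (fun _ : I => R) in
  (forall h, C h -> continuous (h : T -> R)) -> continuous (g : T -> R) ->
  let K := [set f : I -> R | (forall i, `|f i| <= k) /\ (forall h, C h -> 0 <= h f)] in
  K !=set0 -> exists2 f, K f & forall f', K f' -> g f <= g f'.
Proof.
move=> T cC cg K K0.
(* Points are functions rather than matrices, so that Tychonoff applies to the box; the constraints
   cut out a closed subset. *)
have cK : compact (K : set T).
  have -> : K = [set f : T | forall i, `[- k, k]%classic (f i)] `&`
                  \bigcap_(h in C) (h @^-1` [set x | 0 <= x]).
    apply/seteqP; split=> f [fk fC]; split=> // i; have := fk i;
      by rewrite /= in_itv /= ler_norml.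
  apply: compact_closedI.
    by apply: (@tychonoff I (fun=> R) (fun=> `[- k, k]%classic)) => i; apply: segment_compact.
  apply: closed_bigI => h Ch; apply: preimage_closed; last exact: closed_ge.
  by move=> f _; apply: cC.
have [f /set_mem Kf gf] := @compact_EVT_min T R g K K0 cK (continuous_subspaceT cg).
by exists f => // f' /mem_set/gf.
Qed.

(** * Attainment of the minimum in the Schrijver theta function *)

Section SchrijverMinimum.
Variables (R : realType) (n : nat) (n_gt0 : (0 < n)%N) (G : sgraph n).
Let i0 := Ordinal n_gt0.

(* [B = L%:M - A] for a feasible [A] normalised to have unit diagonal; then
   [L = B i0 i0 + 1]. *)
Definition schrijver_slack (B : 'M[R]_n) : Prop :=
  [/\ psd B, forall i j, B i i = B j j
    & forall i j, i != j -> ~~ G i j -> B i j <= -1].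

(** Adding the nonnegative diagonal [A i i - 1] keeps the matrix positive semidefinite and lowers
    the diagonal of [A] to 1. *)
Lemma schrijver_slack_exists L A : schrijver_feasible G A -> psd (L%:M - A) ->
  exists2 B, schrijver_slack B & B i0 i0 = L - 1.
Proof.
move=> [sA fA] pA; pose d := \row_i (A i i - 1).
have BE i : (L%:M - A + diag_mx d) i i = L - 1.
  by rewrite !mxE eqxx !mulr1n; ring.
exists (L%:M - A + diag_mx d) => //; split=> [|i j|i j ij nG].
- apply/psd_bform; split.
    by rewrite /symmetric_mx linearD /= pA.1 tr_diag_mx.
  move=> y; rewrite bformD addr_ge0 ?(pA.2 y) // bform_diag sumr_ge0 // => i _.
  by rewrite mulr_ge0 ?sqr_ge0 // mxE subr_ge0 fA ?eqxx.
- by rewrite !BE.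
- by rewrite !mxE (negPf ij) !mulr0n addr0 add0r lerN2 fA // nG orbT.
Qed.

Lemma schrijver_slack_feasible B : schrijver_slack B ->
  schrijver_feasible G ((B i0 i0 + 1)%:M - B).
Proof.
move=> [pB dB oB]; split; first exact: symmetric_scalar_sub pB.1.
move=> i j; have [<- _|ij /= nG] := eqVneq i j.
  by rewrite !mxE eqxx mulr1n (dB i i0) addrAC subrr add0r.
by rewrite !mxE (negPf ij) mulr0n sub0r lerNr oB.
Qed.

Lemma schrijver_slack_min : (exists B, schrijver_slack B) ->
  exists2 B, schrijver_slack B
    & forall B', schrijver_slack B' -> B i0 i0 <= B' i0 i0.
Proof.
move=> [B0 sB0]; pose I := ('I_n * 'I_n)%type.
pose mx (f : I -> R) := \matrix_(i, j) f (i, j).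
(* Each equality of entries, for symmetry or for the constant diagonal, becomes two opposite
   differences. The other constraints are the entry bounds and one quadratic form for each [y]. *)
pose C : set ((I -> R) -> R) := [set h |
  [\/ exists2 pq : I * I, pq.1 = (pq.2.2, pq.2.1) \/
        pq.1.1 = pq.1.2 /\ pq.2.1 = pq.2.2 & h = fun f => f pq.1 - f pq.2,
      exists2 p : I, p.1 != p.2 /\ ~~ G p.1 p.2 & h = fun f => - 1 - f p
    | exists y : 'cV[R]_n, h = fun f => bform (mx f) y y]].
have slackC f : schrijver_slack (mx f) <-> forall h, C h -> 0 <= h f.
  split=> [[pB dB oB] h|hC].
    case=> [[[[i j] [k l]] /= E ->]|[[i j] /= [ij nG] ->]|[y ->]].
    - rewrite subr_ge0; case: E => [[-> ->]|[-> ->]].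
        by move/symmetric_mxP/(_ k l): pB.1; rewrite !mxE => ->.
      by have := dB j l; rewrite !mxE => ->.
    - by have := oB _ _ ij nG; rewrite mxE subr_ge0.
    - exact: pB.2.
  split=> [|i j|i j ij nG].
  - apply/psd_bform; split=> [|y]; last first.
      by apply: (hC (fun f => bform (mx f) y y)); constructor 3; exists y.
    apply/symmetric_mxP => i j; apply/eqP; rewrite !mxE eq_le.
    have := hC (fun f => f (i, j) - f (j, i)); rewrite subr_ge0 => ->.
      have := hC (fun f => f (j, i) - f (i, j)); rewrite subr_ge0 => -> //.
      by constructor 1; exists ((j, i), (i, j)) => //; left.
    by constructor 1; exists ((i, j), (j, i)) => //; left.
  - apply/eqP; rewrite !mxE eq_le.
    have := hC (fun f => f (i, i) - f (j, j)); rewrite subr_ge0 => ->.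
      have := hC (fun f => f (j, j) - f (i, i)); rewrite subr_ge0 => -> //.
      by constructor 1; exists ((j, j), (i, i)) => //; right.
    by constructor 1; exists ((i, i), (j, j)) => //; right.
  - rewrite mxE -subr_ge0; apply: (hC (fun f => - 1 - f (i, j))).
    by constructor 2; exists (i, j).
pose T := prod_topology (fun _ : I => R).
have cproj (p : I) : continuous (fun f : T => f p).
  by apply: (@proj_continuous I (fun=> R)).
have cC h : C h -> continuous (h : T -> R).
  case=> [[pq _ ->]|[p _ ->]|[y ->]] f.
  - exact: (continuousB (cproj pq.1 f) (cproj pq.2 f)).
  - exact: (continuousB (@cst_continuous T R _ f) (cproj p f)).
  - have -> : (fun f => bform (mx f) y y) =
      (fun f => \sum_i \sum_j y i 0 * f (i, j) * y j 0).
      by apply/funext => g; rewrite bformE; apply: eq_bigr => i _;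
         apply: eq_bigr => j _; rewrite mxE.
    move: f; apply: (@continuous_big R _ _ _ _ _ T) => [|i _]; first exact: add_continuous.
    apply: (@continuous_big R _ _ _ _ _ T) => [|j _ f]; first exact: add_continuous.
    have cc (a : R) : {for f, continuous (fun _ : T => a)} by exact: cst_continuous.
    exact: (continuousM (continuousM (cc (y i 0)) (cproj (i, j) f)) (cc (y j 0))).
(* Only matrices whose diagonal does not exceed that of [B0] matter, and positive semidefiniteness
   bounds all their entries by [k]. *)
pose k := B0 i0 i0.
have boxB (B : 'M[R]_n) : schrijver_slack B -> B i0 i0 <= k -> forall i j, `|B i j| <= k.
  move=> [pB dB _] Bk i j; apply: psd_entry_le pB _ => l.
  by rewrite (dB l i0).
have mxf (B : 'M[R]_n) : mx (fun p => B p.1 p.2) = B by apply/matrixP => i j; rewrite mxE.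
have [|f [_ /slackC sf] minf] := @compact_constraints_min R I k C (fun f => f (i0, i0)) cC (cproj (i0, i0)).
  exists (fun p => B0 p.1 p.2); split=> [i|]; first exact: boxB.
  by apply/slackC; rewrite mxf.
exists (mx f) => // B' sB'.
have kB (B : 'M[R]_n) : schrijver_slack B -> B i0 i0 <= k -> mx f i0 i0 <= B i0 i0.
  move=> sB Bk; rewrite mxE; apply: (minf (fun p => B p.1 p.2)); split.
    by move=> i; apply: boxB.
  by apply/slackC; rewrite mxf.
(* If the diagonal of [B'] exceeds [k], the minimiser is compared with [B0] instead. *)
have [/kB|/ltW] := leP (B' i0 i0) k; first exact.
by apply: le_trans; apply: kB.
Qed.

Lemma schrijver_min_exists : exists (L : R) A,
  [/\ schrijver_feasible G A, psd (L%:M - A)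
    & forall L' A', schrijver_feasible G A' -> psd (L'%:M - A') -> L <= L'].
Proof.
have [B sB minB] : exists2 B, schrijver_slack B
    & forall B', schrijver_slack B' -> B i0 i0 <= B' i0 i0.
  apply: schrijver_slack_min; pose A : 'M[R]_n := const_mx 1.
  have fA : schrijver_feasible G A.
    by split=> [|i j _]; rewrite ?mxE // /symmetric_mx trmx_const.
  have [l _ pl] := largest_eigenvalue_exists n_gt0 fA.1.
  by have [B sB _] := schrijver_slack_exists fA pl; exists B.
exists (B i0 i0 + 1), ((B i0 i0 + 1)%:M - B); split.
- exact: schrijver_slack_feasible.
- by rewrite opprB addrC subrK; case: sB.
- move=> L' A' fA' pA'; have [B' sB' BE] := schrijver_slack_exists fA' pA'.
  by rewrite -lerBrDr -BE minB.
Qed.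

End SchrijverMinimum.

(** * The theta function as a lower bound for [F] *)

Section Theta.
Variables (R : realType) (n : nat) (n_gt0 : (0 < n)%N) (G : sgraph n).
Implicit Types (M : 'M[R]_n) (u w x y z : 'cV[R]_n).
Local Notation theta := (schrijver_theta R G).
Local Notation ones := (const_mx 1 : 'cV[R]_n).

(** The least [L] with [psd (L%:M - A)] for some feasible [A] is the largest eigenvalue of its [A].
    It is therefore an attained lower bound of [schrijver_values], hence their infimum. *)
Lemma schrijver_theta_min :
  [/\ is_minimum (schrijver_values R G) theta,
      exists2 A : 'M[R]_n, schrijver_feasible G A & psd (theta%:M - A)
    & forall L (A : 'M[R]_n),
        schrijver_feasible G A -> psd (L%:M - A) -> theta <= L].
Proof.
have [L [A [fA pA minL]]] := schrijver_min_exists R n_gt0 G.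
have [l el pl] := largest_eigenvalue_exists n_gt0 fA.1.
have lL : l = L.
  by apply/eqP; rewrite eq_le (eigenvalue_le_psd el.1) // (minL _ _ fA).
have SL : schrijver_values R G L by exists A => //; rewrite -lL.
have lbL : lbound (schrijver_values R G) L.
  by move=> m [A' fA' /(largest_eigenvalue_psd n_gt0 fA'.1)]; apply: minL.
have thetaE : theta = L.
  apply/eqP; rewrite eq_le /schrijver_theta ge_inf ?lb_le_inf //.
    by exists L.
  by exists L.
by rewrite thetaE; split=> //; exists A.
Qed.

Lemma le_max_ratio M x i : M i i / x i 0 ^+ 2 <= max_ratio M x.
Proof. by rewrite /max_ratio (bigD1 i) //= le_max lexx. Qed.

Lemma max_ratio_ge0 (M : 'M[R]_n) x : 0 <= max_ratio M x.
Proof. exact: bigmax_ge_id. Qed.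

Lemma bform_ones (N : 'M[R]_n) u z : N *m z = ones ->
  bform N u z = \sum_i u i 0.
Proof.
move=> Nz; rewrite /bform -mulmxA Nz mxE.
by apply: eq_bigr => i _; rewrite !mxE mulr1.
Qed.

(* The diagonal congruence [D^-1 M D^-1], [D = diag x], reduces [(M, x)] to a
   pair whose vector is all ones. *)
Lemma PG_normalize (M : 'M[R]_n) x : PG R G (M, x) ->
  let N := \matrix_(i, j) (M i j / (x i 0 * x j 0)) in
  exists z, [/\ psd N, N *m z = ones,
    forall i j, i != j -> ~~ G i j -> N i j <= 0
    & F M x = (\sum_i z i 0) * max_ratio M x].
Proof.
move=> [pM [y xE] x0 oM] N; rewrite /= in pM xE x0 oM.
have Nb u : bform N u u = bform M (\col_i (u i 0 / x i 0)) (\col_i (u i 0 / x i 0)).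
  rewrite !bformE; apply: eq_bigr => i _; apply: eq_bigr => j _; rewrite !mxE.
  by have := x0 i; have := x0 j => xj xi; field; rewrite xi xj.
(* With [x = M *m y] and [z = D y], [N z = D^-1 M y = D^-1 x] is the all-ones vector. *)
exists (\col_i (x i 0 * y i 0)); split.
- apply/psd_bform; split=> [|u]; last by rewrite Nb; apply: pM.2.
  apply/symmetric_mxP => i j; rewrite !mxE [x j 0 * _]mulrC.
  by rewrite (proj1 (symmetric_mxP M) pM.1).
- apply/matrixP => i j; have := x0 i; rewrite !mxE => /mulVf <-.
  have {2}-> : x i 0 = \sum_k M i k * y k 0 by rewrite {1}xE mxE.
  rewrite mulr_sumr; apply: eq_bigr => k _; rewrite !mxE.
  by have := x0 i; have := x0 k => xk xi; field; rewrite xi xk.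
- move=> i j ij nG; have := oM i j ij nG; rewrite mxE -mulrA => oij.
  rewrite -(@pmulr_lle0 _ ((x i 0 * x j 0) ^+ 2)).
    congr (_ <= 0) : oij; have := x0 i; have := x0 j => xj xi.
    by field; rewrite xi xj.
  by rewrite lt_neqAle sqr_ge0 eq_sym sqrf_eq0 mulf_neq0.
- rewrite {1 2}xE F_rangeE // -xE; congr (_ * _).
  rewrite /bform -mulmxA -xE mxE; apply: eq_bigr => i _.
  by rewrite !mxE mulrC.
Qed.

Lemma schrijver_theta_le_normalized (N : 'M[R]_n) z c : psd N ->
  N *m z = ones -> (forall i, N i i <= c) ->
  (forall i j, i != j -> ~~ G i j -> N i j <= 0) ->
  theta <= (\sum_i z i 0) * c.
Proof.
move=> pN Nz dN oN; have [_ _ minT] := schrijver_theta_min.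
pose s := \sum_i z i 0.
have s0 : 0 <= s by rewrite /s -(bform_ones z Nz); apply: pN.2.
(* This makes every diagonal entry of [S] equal to [s * c - 1], so that [(s * c)%:M - S] has unit
   diagonal. *)
pose d := \row_i (s * (c - N i i)).
pose S := s *: N - const_mx 1 + diag_mx d.
have sS : symmetric_mx S.
  by rewrite /symmetric_mx linearD linearB linearZ /= tr_diag_mx trmx_const pN.1.
apply: (minT _ ((s * c)%:M - S)).
  split=> [|i j]; first exact: symmetric_scalar_sub.
  rewrite !mxE; have [<- _|ij /= nG] := eqVneq i j.
    by rewrite !mulr1n; lra.
  rewrite !mulr0n addr0 sub0r opprB lerDl oppr_ge0.
  by rewrite mulr_ge0_le0 // oN.
rewrite opprB addrC subrK; apply/psd_bform; split=> // y.
rewrite bformD bformB bformZ bform_const bform_diag addr_ge0 //.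
  (* The sum of the entries of [y] is [bform N y z], so Cauchy-Schwarz bounds its square by
     [s * bform N y y]. *)
  rewrite subr_ge0 mulrC -expr2 -(bform_ones y Nz).
  have := bform_cauchy_schwarz y z pN.
  by rewrite (bform_ones z Nz) (mulrC s).
by apply: sumr_ge0 => i _; rewrite mulr_ge0 ?sqr_ge0 // mxE mulr_ge0 // subr_ge0.
Qed.

Lemma schrijver_theta_le_F (M : 'M[R]_n) x : PG R G (M, x) -> theta <= F M x.
Proof.
move=> Mx; have [z [pN Nz oN ->]] := PG_normalize Mx.
apply: schrijver_theta_le_normalized pN Nz _ oN => i.
by rewrite mxE -expr2 le_max_ratio.
Qed.

(** The range of a symmetric matrix is the orthogonal complement of its kernel. *)
Lemma psd_const_range (N : 'M[R]_n) : symmetric_mx N ->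
  (forall w : 'cV[R]_n, N *m w = 0 -> \sum_i w i 0 = 0) ->
  exists z, N *m z = ones.
Proof.
move=> sN kN; have /submxP[D DE] : (ones^T <= N)%MS.
  rewrite submxE; apply/eqP/matrixP => i j; rewrite !mxE.
  rewrite -[RHS](kN (col j (cokermx N))).
    by apply: eq_bigr => k _; rewrite !mxE mul1r.
  by rewrite colE mulmxA mulmx_coker mul0mx.
by exists D^T; rewrite -[N in LHS]sN -trmx_mul -DE trmxK.
Qed.

(** * The admissible pair built from an optimal matrix *)

Section Optimal.
Variable A : 'M[R]_n.
Hypotheses (fA : schrijver_feasible G A) (pA : psd (theta%:M - A)).
Local Notation N := (theta%:M - A + const_mx 1).

Lemma schrijver_theta_ge1 : 1 <= theta.
Proof.
have := psd_diag_ge0 (Ordinal n_gt0) pA; rewrite !mxE eqxx mulr1n subr_ge0.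
by apply: le_trans; apply: fA.2; rewrite eqxx.
Qed.

Lemma optimal_bform u : bform N u u =
  bform (theta%:M - A) u u + (\sum_i u i 0) ^+ 2.
Proof. by rewrite bformD bform_const expr2. Qed.

Lemma optimal_psd : psd N.
Proof.
apply/psd_bform; split; first by rewrite /symmetric_mx linearD /= pA.1 trmx_const.
by move=> u; rewrite optimal_bform addr_ge0 ?sqr_ge0 ?(pA.2 u).
Qed.

Lemma optimal_diag_le i : N i i <= theta.
Proof.
rewrite !mxE eqxx mulr1n; have : 1 <= A i i by apply: fA.2; rewrite eqxx.
lra.
Qed.

(** On the kernel of [N] both nonnegative terms of [optimal_bform] vanish, in particular the squared
    sum of entries. *)
Lemma optimal_range : exists z, N *m z = ones.
Proof.
apply: psd_const_range; first exact: optimal_psd.1.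
move=> w Nw; have := optimal_bform w.
rewrite {1}/bform -mulmxA Nw mulmx0 mxE => /esym/eqP.
by rewrite paddr_eq0 ?sqr_ge0 ?(pA.2 w) // sqrf_eq0 => /andP[_ /eqP].
Qed.

Lemma optimal_PG : PG R G (N, ones).
Proof.
split=> /=; first exact: optimal_psd.
- by have [z <-] := optimal_range; exists z.
- by move=> i; rewrite mxE oner_neq0.
move=> i j ij nG; rewrite !mxE (negPf ij) mulr0n !mulr1.
have : 1 <= A i j by apply: fA.2; rewrite nG orbT.
lra.
Qed.

Lemma optimal_max_ratio_le : max_ratio N ones <= theta.
Proof.
(* The default value 0 of the maximum must also lie below [theta]. *)
apply: bigmax_le => [|u _]; first exact: le_trans ler01 schrijver_theta_ge1.
by rewrite [X in _ / X ^+ 2]mxE expr1n divr1 optimal_diag_le.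
Qed.

(** Let [s] be the sum of the entries of [z]. Then [s = bform N z z >= s ^+ 2], so [s <= 1], while
    the largest ratio is at most [theta]. *)
Lemma optimal_F : F N ones = theta.
Proof.
apply/eqP; rewrite eq_le schrijver_theta_le_F ?andbT; last exact: optimal_PG.
have [z Nz] := optimal_range; rewrite -Nz F_rangeE; last exact: optimal_psd.
rewrite Nz (bform_ones z Nz) -[leRHS]mul1r.
have s0 : 0 <= \sum_i z i 0.
  by rewrite -(bform_ones z Nz); apply: optimal_psd.2.
apply: ler_pM; rewrite ?max_ratio_ge0 ?optimal_max_ratio_le //.
have := optimal_bform z; rewrite (bform_ones z Nz).
have := pA.2 z; rewrite -/(bform _ z z); nra.
Qed.

End Optimal.

(** * Independent sets and their indicator vectors *)

Definition indicator_cV (C : {set 'I_n}) : 'cV[R]_n :=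
  \col_i (i \in C)%:R.

Lemma sum_indicator C (f : 'I_n -> R) :
  \sum_i indicator_cV C i 0 * f i = \sum_(i in C) f i.
Proof.
rewrite [RHS]big_mkcond; apply: eq_bigr => i _.
by rewrite mxE; case: ifP => _; rewrite ?mul1r ?mul0r.
Qed.

Lemma sum_indicator1 C : \sum_i indicator_cV C i 0 = #|C|%:R.
Proof.
have := sum_indicator C (fun=> 1); under eq_bigr do rewrite mulr1.
by move=> ->; rewrite sumr_const.
Qed.

Lemma bform_indicator M C :
  bform M (indicator_cV C) (indicator_cV C) =
  \sum_(i in C) \sum_(j in C) M i j.
Proof.
rewrite bformE -sum_indicator; apply: eq_bigr => i _.
rewrite -[in RHS]sum_indicator mulr_sumr; apply: eq_bigr => j _; ring.
Qed.

Lemma mulmx_indicator M C i :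
  (M *m indicator_cV C) i 0 = \sum_(j in C) M i j.
Proof.
by rewrite mxE -sum_indicator; apply: eq_bigr => j _; rewrite mulrC.
Qed.

Lemma independentP C i j : independent G C -> i \in C -> j \in C -> ~~ G i j.
Proof. by move=> /forall_inP CP iC jC; move/forall_inP: (CP i iC); apply. Qed.

(** For optimal [A] and [l = theta] both terms on the left are nonnegative. This yields the bound on
    [#|C|], and both terms vanish when it is attained. *)
Lemma feasible_indicator_slack (A : 'M[R]_n) C l : independent G C ->
  schrijver_feasible G A ->
  bform (l%:M - A) (indicator_cV C) (indicator_cV C)
  + \sum_(i in C) \sum_(j in C) (A i j - 1) = #|C|%:R * (l - #|C|%:R).
Proof.
move=> iC [sA fA]; rewrite bformB bform_scalar bform_indicator.
under [X in l * X]eq_bigr do rewrite expr2.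
under [X in _ + X]eq_bigr do rewrite sumrB sumr_const.
rewrite sumrB sumr_const sum_indicator.
under [X in l * X]eq_bigr => i Ci do rewrite mxE Ci.
rewrite sumr_const mulr_natr -mulrnA natrM; ring.
Qed.

Lemma feasible_indicator_ge0 (A : 'M[R]_n) C i j : independent G C ->
  schrijver_feasible G A -> i \in C -> j \in C -> 0 <= A i j - 1.
Proof.
by move=> iC fA Ci Cj; rewrite subr_ge0 fA.2 // (independentP iC) ?orbT.
Qed.

Lemma card_independent_le C : independent G C -> #|C|%:R <= theta.
Proof.
move=> iC; have [_ [A fA pA] _] := schrijver_theta_min.
have := feasible_indicator_slack theta iC fA.
have := pA.2 (indicator_cV C); rewrite -/(bform _ _ _).
have : 0 <= \sum_(i in C) \sum_(j in C) (A i j - 1).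
  apply: sumr_ge0 => i Ci; apply: sumr_ge0 => j Cj.
  exact: feasible_indicator_ge0 iC fA Ci Cj.
(* Needed for empty [C], where the factor [#|C|%:R] cannot be cancelled. *)
have t1 := schrijver_theta_ge1 fA pA.
have : 0 <= #|C|%:R :> R by [].
nra.
Qed.

Lemma alpha_attained : exists2 C, independent G C & #|C| = alpha G.
Proof.
have i0 : independent G finset.set0 by apply/forall_inP => i; rewrite inE.
have := @eq_bigmax_cond _ [pred C | independent G C] (fun C => #|C|).
case=> [|C iC aC]; first by apply/card_gt0P; exists finset.set0.
by exists C => //; rewrite -aC.
Qed.

Lemma card_independent_le_alpha C : independent G C -> (#|C| <= alpha G)%N.
Proof. by move=> iC; apply: leq_bigmax_cond. Qed.

Lemma alpha_le_schrijver_theta : (alpha G)%:R <= theta.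
Proof. by have [C iC <-] := alpha_attained; apply: card_independent_le. Qed.

(** * The tightness condition and the equality case *)

Lemma principal_submx_diagP M C : is_diag_mx (principal_submx M C) <->
  forall i j, i \in C -> j \in C -> i != j -> M i j = 0.
Proof.
split=> [/is_diag_mxP dM i j Ci Cj ij|dM].
  have := dM (enum_rank_in Ci i) (enum_rank_in Ci j).
  rewrite mxE !enum_rankK_in //; apply; apply: contraNneq ij => /val_inj e.
  by rewrite -(enum_rankK_in Ci Ci) e enum_rankK_in.
apply/is_diag_mxP => k l kl; rewrite mxE dM ?enum_valP //.
by apply: contra_neq kl => /enum_val_inj ->.
Qed.

Lemma tight_pair_theta_le M x C : PG R G (M, x) ->
  is_diag_mx (principal_submx M C) ->
  (forall v, v \in C -> M v v / x v 0 ^+ 2 = max_ratio M x) ->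
  (forall v, v \notin C ->
     max_ratio M x * x v 0 = \sum_(u in C) M v u * (x u 0)^-1) ->
  theta <= #|C|%:R.
Proof.
move=> Mx /principal_submx_diagP dM MC MnC; set c := max_ratio M x in MC MnC *.
apply: le_trans (schrijver_theta_le_F Mx) _.
have x0 : forall i, x i 0 != 0 by case: Mx.
have [z] := PG_normalize Mx; set N := \matrix_(i, j) _ => -[pN Nz _ ->].
(* After normalisation the tightness condition is this one equation. Pairing it with [z] gives
   [#|C|] on one side and [c] times the sum of [z] on the other. *)
suff NC : N *m indicator_cV C = c *: ones.
  rewrite -/c -sum_indicator1 -(bform_ones (indicator_cV C) Nz) (bform_sym _ _ pN.1).
  rewrite /bform -mulmxA NC -scalemxAr mxE mulrC.
  suff -> : (z^T *m ones) 0 0 = \sum_i z i 0 by [].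
  by rewrite mxE; apply: eq_bigr => i _; rewrite !mxE mulr1.
apply/matrixP => v k; rewrite ord1 mulmx_indicator !mxE mulr1.
have [Cv|nCv] := boolP (v \in C).
  rewrite (bigD1 v) //= big1 ?addr0 => [|u /andP[Cu uv]].
    by rewrite mxE -expr2 MC.
  by rewrite mxE dM ?mul0r // eq_sym.
rewrite -[c](mulfK (x0 v)) MnC // mulr_suml; apply: eq_bigr => u _.
by rewrite mxE invfM mulrA mulrAC.
Qed.

Lemma tight_pair_exists : (alpha G)%:R = theta ->
  exists M x C, [/\ PG R G (M, x), independent G C
    & let c := max_ratio M x in
      [/\ is_diag_mx (principal_submx M C),
          forall v, v \in C -> M v v / x v 0 ^+ 2 = c
        & forall v, v \notin C ->
            c * x v 0 = \sum_(u in C) M v u * (x u 0)^-1]].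
Proof.
move=> alphaE; have [_ [A fA pA] _] := schrijver_theta_min.
have [C iC cC] := alpha_attained; have Ct : #|C|%:R = theta by rewrite cC.
have Age i j : i \in C -> j \in C -> 0 <= A i j - 1.
  exact: feasible_indicator_ge0.
have A2 i : i \in C -> 0 <= \sum_(j in C) (A i j - 1).
  by move=> Ci; apply: sumr_ge0 => j; apply: Age.
(* The right-hand side is 0 here, so [theta%:M - A] annihilates the indicator vector and [A] is 1 on
   [C]. *)
have /eqP := feasible_indicator_slack theta iC fA.
rewrite Ct subrr mulr0 paddr_eq0; [|exact: pA.2|exact: sumr_ge0].
move=> /andP[/eqP/(psd_bform_eq0 pA) TC /eqP A0].
have AC i j : i \in C -> j \in C -> A i j = 1.
  move=> Ci Cj; apply/eqP; rewrite -subr_eq0; apply/eqP.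
  have Ai : \sum_(j in C) (A i j - 1) = 0 by apply: (psumr_eq0P A2 A0).
  by apply: (psumr_eq0P _ Ai) => // k Ck; apply: Age.
pose N := theta%:M - A + const_mx 1.
have Nvv v : v \in C -> N v v = theta.
  by move=> Cv; rewrite !mxE AC // eqxx mulr1n subrK.
have cE : max_ratio N ones = theta.
  apply/eqP; rewrite eq_le optimal_max_ratio_le //=.
  (* As [theta >= 1], [C] is nonempty, and the ratio [theta] is reached at any of its vertices. *)
  have /card_gt0P[v Cv] : (0 < #|C|)%N.
    by rewrite -(ltr0n R) Ct (lt_le_trans ltr01) ?(schrijver_theta_ge1 fA).
  by rewrite -{1}(Nvv v Cv) (le_trans _ (le_max_ratio N ones v)) // !mxE expr1n divr1.
exists N, ones, C; split=> //; first exact: optimal_PG.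
rewrite /= cE; split.
- apply/principal_submx_diagP => i j Ci Cj ij.
  by rewrite !mxE AC // (negPf ij) mulr0n add0r addNr.
- by move=> v Cv; rewrite Nvv // mxE expr1n divr1.
- move=> v _; rewrite mxE mulr1.
  under eq_bigr do rewrite [X in _ / X]mxE divr1.
  (* Only the all-ones part of [N] survives, and its row sums over [C] are [#|C| = theta]. *)
  rewrite -mulmx_indicator mulmxDl TC add0r -Ct.
  rewrite mulmx_indicator.
  under eq_bigr do rewrite mxE.
  by rewrite sumr_const.
Qed.

End Theta.

(** * Both minima, the bound on the independence number, and its equality case *)

Theorem theorem5p1 (R : realType) (n : nat) (n_gt0 : (0 < n)%N)
    (G : sgraph n) :
  [/\ is_minimum (schrijver_values R G) (schrijver_theta R G),
      is_minimum (F_values R G) (schrijver_theta R G),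
      (alpha G)%:R <= schrijver_theta R G
    & (alpha G)%:R = schrijver_theta R G <->
      exists (M : 'M[R]_n) (x : 'cV[R]_n) (C : {set 'I_n}),
        [/\ PG R G (M, x), independent G C
          & let c := max_ratio M x in
            [/\ is_diag_mx (principal_submx M C),
                forall v, v \in C -> M v v / x v 0 ^+ 2 = c
              & forall v, v \notin C ->
                  c * x v 0 = \sum_(u in C) M v u * (x u 0)^-1]]].
Proof.
have [min_theta [A fA pA] _] := schrijver_theta_min R n_gt0 G.
split=> //; last split.
- split; last by move=> _ [[M x] Mx <-]; apply: schrijver_theta_le_F.
  exists ((schrijver_theta R G)%:M - A + const_mx 1, const_mx 1).
    exact: optimal_PG.
  exact: optimal_F.
- exact: alpha_le_schrijver_theta.
- exact: tight_pair_exists.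
- move=> [M [x [C [Mx iC [dM MC MnC]]]]]; apply/eqP.
  rewrite eq_le alpha_le_schrijver_theta //=.
  (* The chain is [theta <= #|C| <= alpha G]. *)
  apply: le_trans (tight_pair_theta_le n_gt0 Mx dM MC MnC) _.
  by rewrite ler_nat card_independent_le_alpha.
Qed.
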